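(* Let $\Gamma^1=(G_1,\sigma_1,\mu_1)$ be any signed graph with $n_1$ vertices and $m_1$ edges, let $\theta$ be any $r$-orientation of the edges of $\Gamma^1$, and let $\Gamma^2=(G_2,\sigma_2,\mu_2)$ be a $\gamma$-regular signed graph on $n_2$ vertices. Then $$f_{P((\Gamma^1\diamond\Gamma^2)_\theta)}(\lambda)=\prod_{j=1}^{n_2}\Big(\lambda-\frac{\gamma}{\gamma+2}\lambda_j(P(\Gamma^2))\Big)^{m_1}\prod_{j=1}^{n_1}\Big[\lambda-\frac{\lambda_j(P(\Gamma^1))}{n_2+1}-\frac{1+\lambda_j(P(\Gamma^1))}{n_2+1}\Sigma_{A(\Gamma^2)}(\gamma\lambda+2\lambda)\Big],$$ where $\lambda_j(P(\Gamma^i))$ denote the eigenvalues of $P(\Gamma^i)$.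
   Context: A signed graph $\Gamma=(G,\sigma,\mu)$ has a finite simple graph $G$ with vertices $v_1,\dots,v_n$, signature $\sigma:E(G)\to\{\pm1\}$ and marking $\mu:V(G)\to\{\pm1\}$; $\mu(\Gamma)=(\mu(v_1),\dots,\mu(v_n))^T$. $A(\Gamma)$ has $(i,j)$ entry $\sigma(v_iv_j)$ if $v_i\sim v_j$ and $0$ otherwise; $D(\Gamma)$ is the diagonal matrix of (unsigned) degrees; $P(\Gamma)=D(\Gamma)^{-1}A(\Gamma)$ (this requires all degrees to be positive); the normalized Laplacian is $D^{-1/2}(D-A)D^{-1/2}$, with eigenvalues $1-$ those of $P$. $\gamma$-regular means all degrees equal $\gamma$. $f_M(\lambda)=\det(\lambda I-M)$. The signed $N$-coronal is the rational function $\Sigma_N(X)=\mu(\Gamma)^T(XI_n-N)^{-1}\mu(\Gamma)$. An $r$-orientation of $(G,\sigma)$ is a map $\theta:V(G)\times E(G)\to\{-1,0,1\}$ with $\theta(w,uv)=0$ for $w\notin\{u,v\}$, $\theta(u,uv)\in\{\pm1\}$ at endpoints, and $\theta(u,uv)\theta(v,uv)=\sigma(uv)$. The edge corona $(\Gamma^1\diamond\Gamma^2)_\theta$ (with $E(\Gamma^1)=\{e_1,\dots,e_{m_1}\}$) is obtained from $\Gamma^1$ and $m_1$ disjoint copies of $\Gamma^2$ by joining, for each $t$, both endpoints $u$ of $e_t$ to every vertex $w$ of the $t$-th copy, the edge $uw$ having sign $\theta(u,e_t)\mu_2(w)$, where $\mu_2(w)$ is the marking of the vertex of $\Gamma^2$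 corresponding to $w$. $P((\Gamma^1\diamond\Gamma^2)_\theta)$ uses the degrees of the product graph. *)

(* Defs.v *)
From HB Require Import structures.
From mathcomp Require Import all_boot all_order all_algebra.

Set Implicit Arguments.
Unset Strict Implicit.
Unset Printing Implicit Defensive.

Import Order.TTheory GRing.Theory Num.Theory.
Local Open Scope ring_scope.

Definition is_sign (z : int) : Prop := z = 1 \/ z = -1.

(* A finite simple graph with a signature (G, sigma).  The signature is encoded
   on ordered pairs of vertices: it is symmetric and {1,-1}-valued on adjacent
   pairs, and its values on non-adjacent pairs are never used. *)
Record sigraph (V : finType) := SiGraph {
  adj : rel V;
  adj_sym : symmetric adj;
  adj_irr : irreflexive adj;
  sigma : V -> V -> int;
  sigma_sym : forall u v, adj u v -> sigma u v = sigma v u;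
  sigma_sign : forall u v, adj u v -> is_sign (sigma u v)
}.

(* (G, sigma, mu) *)
Record signed_graph (V : finType) := SignedGraph {
  underlying :> sigraph V;
  mu : V -> int;
  mu_sign : forall v, is_sign (mu v)
}.

Section Graph.
Variables (V : finType) (G : sigraph V).

Definition edge_set : {set {set V}} :=
  [set [set p.1; p.2] | p : V * V & adj G p.1 p.2].

Definition edge : finType := {e : {set V} | e \in edge_set}.

Definition endpoints (e : edge) : {set V} := sval e.

Definition degree (v : V) : nat := #|[set w | adj G v w]|.

Definition regular (gamma : nat) : Prop := forall v, degree v = gamma.

Record r_orientation := ROrientation {
  theta :> V -> edge -> int;
  theta_out : forall w e, w \notin endpoints e -> theta w e = 0;
  theta_end : forall w e, w \in endpoints e -> is_sign (theta w e);
  theta_sigma : forall u v e, endpoints e = [set u; v] ->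
    theta u e * theta v e = sigma G u v
}.

(* Vertices are enumerated by enum_val : 'I_#|V| -> V. *)
Definition adj_mx (F : fieldType) : 'M[F]_#|V| :=
  \matrix_(i, j) if adj G (enum_val i) (enum_val j)
                 then (sigma G (enum_val i) (enum_val j))%:~R else 0.

Definition deg_mx (F : fieldType) : 'M[F]_#|V| :=
  diag_mx (\row_i (degree (enum_val i))%:R).

(* Meaningful only when all degrees are nonzero in F. *)
Definition P_mx (F : fieldType) : 'M[F]_#|V| := invmx (deg_mx F) *m adj_mx F.

End Graph.

Definition marking_vec (F : fieldType) (V : finType) (G : signed_graph V) :
  'cV[F]_#|V| := \col_i (mu G (enum_val i))%:~R.

Section EdgeCorona.
Variables (V1 V2 : finType) (G1 : signed_graph V1).
Variables (th : r_orientation G1) (G2 : signed_graph V2).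

(* inl u is the vertex u of G1; inr (e, w) is the vertex w in the copy of G2
   attached to the edge e. *)
Definition corona_vertex : finType := (V1 + edge G1 * V2)%type.

Definition corona_adj : rel corona_vertex := fun x y =>
  match x, y with
  | inl u, inl v => adj G1 u v
  | inl u, inr (e, _) => u \in endpoints e
  | inr (e, _), inl u => u \in endpoints e
  | inr (e, w), inr (f, z) => (e == f) && adj G2 w z
  end.

Definition corona_sigma (x y : corona_vertex) : int :=
  match x, y with
  | inl u, inl v => sigma G1 u v
  | inl u, inr (e, w) => th u e * mu G2 w
  | inr (e, w), inl u => th u e * mu G2 w
  | inr (_, w), inr (_, z) => sigma G2 w z
  end.

Lemma corona_adj_sym : symmetric corona_adj.
Proof.
by case=> [u|[e w]] [v|[f z]] //=; rewrite adj_sym // eq_sym.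
Qed.

Lemma corona_adj_irr : irreflexive corona_adj.
Proof. by case=> [u|[e w]] /=; rewrite adj_irr ?andbF. Qed.

Lemma corona_sigma_sym x y :
  corona_adj x y -> corona_sigma x y = corona_sigma y x.
Proof.
case: x y => [u|[e w]] [v|[f z]] //=; first exact: sigma_sym.
by case/andP=> _; apply: sigma_sym.
Qed.

Lemma is_signM a b : is_sign a -> is_sign b -> is_sign (a * b).
Proof. by case=> ->; case=> ->; [left | right | right | left]. Qed.

Lemma corona_sigma_sign x y : corona_adj x y -> is_sign (corona_sigma x y).
Proof.
case: x y => [u|[e w]] [v|[f z]] /=; first exact: sigma_sign.
- by move=> he; apply: is_signM; [apply: theta_end | apply: mu_sign].
- by move=> he; apply: is_signM; [apply: theta_end | apply: mu_sign].
- by case/andP=> _; apply: sigma_sign.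
Qed.

(* Its marking plays no role in P, so the edge corona is built as (G, sigma). *)
Definition edge_corona : sigraph corona_vertex :=
  SiGraph corona_adj_sym corona_adj_irr corona_sigma_sym corona_sigma_sign.

End EdgeCorona.

(* lam lists the eigenvalues of M with algebraic multiplicity. *)
Definition eigenvalues_of (F : fieldType) (n : nat) (M : 'M[F]_n)
  (lam : 'I_n -> F) : Prop :=
  char_poly M = \prod_(j < n) ('X - (lam j)%:P).

Lemma eigenvalues_of_exists (F : closedFieldType) (n : nat) (M : 'M[F]_n) :
  exists lam, eigenvalues_of M lam.
Proof.
have [r] := closed_field_poly_normal (char_poly M).
rewrite (eqP (char_poly_monic M)) scale1r => def_r.
have sz_r : size r = n.
  by apply: succn_inj; rewrite -(size_prod_XsubC r id) -def_r size_char_poly.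
exists (fun j => r`_j); rewrite /eigenvalues_of def_r (big_nth 0) sz_r.
by rewrite big_mkord.
Qed.

Notation ratfun F := {fraction {poly F}}.

Definition ratX (F : fieldType) : ratfun F := FracField.tofrac 'X.

Definition ratC (F : fieldType) (a : F) : ratfun F := FracField.tofrac a%:P.

(* The signed coronal as a rational function, with t substituted for its
   variable.  The matrix is invertible whenever t is non-constant. *)
Definition coronal (F : fieldType) (V : finType) (G : signed_graph V)
  (N : 'M[F]_#|V|) (t : ratfun F) : ratfun F :=
  let m := map_mx (@ratC F) (marking_vec F G) in
  (m^T *m invmx (t%:M - map_mx (@ratC F) N) *m m) 0 0.

(* Main.v *)
From HB Require Import structures.
Require Import Defs.
From mathcomp Require Import all_boot all_order all_algebra all_fingroup ring.
Import GRing.Theory Num.Theory.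
Local Open Scope ring_scope.

(** Order the vertices of the edge corona as V1 followed by one copy of V2 per
    edge of G1.  With a = 1/(n2 + 1), b = 1/(gamma + 2), R the V1 x E(G1) matrix
    of theta and D1 the degree matrix of G1, the matrix lambda I - P is then
<<
      [ lambda - a P1           - a D1^-1 R (x) mu^T      ]
      [ - b R^T (x) mu          I (x) (lambda - b A2)     ]
>>
    because the degrees in the corona are (n2 + 1) deg(u) and gamma + 2.  The
    Schur complement of the lower right block only involves R R^T = D1 + A1 and
    the scalar b mu^T (lambda - b A2)^-1 mu, which is the coronal S at
    (gamma + 2) lambda; hence it equals lambda - a P1 - a S (I + P1), an affine
    function of P1. *)

(** * Determinant identities *)

Lemma det_reindex (R : comNzRingType) (T : finType) (f : T -> T -> R) (n : nat)
    (h : 'I_n -> T) : bijective h ->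
  \det (\matrix_(i < #|T|, j < #|T|) f (enum_val i) (enum_val j)) =
  \det (\matrix_(i < n, j < n) f (h i) (h j)).
Proof.
move=> bij_h; have cTn : n = #|T| by rewrite -(bij_eq_card bij_h) card_ord.
subst n.
have inj_s : injective (fun i => enum_rank (h i)).
  by move=> i j /enum_rank_inj /(bij_inj bij_h).
pose s := perm inj_s; set A := (X in \det X = _).
suff -> : \matrix_(i, j) f (h i) (h j) = row_perm s (col_perm s A).
  (* The same permutation acts on rows and columns, so its sign enters squared and cancels. *)
  rewrite row_permE col_permE !det_mulmx !det_perm odd_permV mulrCA.
  by rewrite -signr_addb addbb mulr1.
by apply/matrixP=> i j; rewrite !mxE !permE !enum_rankK.
Qed.

Lemma det_mxdiag (R : comNzRingType) (m : nat) (p_ : 'I_m -> nat)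
    (B_ : forall i, 'M[R]_(p_ i)) :
  \det (\mxdiag_i B_ i) = \prod_i \det (B_ i).
Proof.
elim: m p_ B_ => [|m IHm] p_ B_.
  rewrite [RHS]big_ord0; move: (\mxdiag_i B_ i); rewrite big_ord0 => M.
  exact: det_mx00.
have det_cast k l (e1 e2 : k = l) (M : 'M[R]_k) :
    \det (castmx (e1, e2) M) = \det M.
  by case: l / e1 e2 => e2; rewrite castmx_id.
by rewrite mxdiag_recl det_cast det_ublock IHm big_ord_recl.
Qed.

Lemma det_schur (R : comUnitRingType) (m n : nat) (A : 'M[R]_m)
    (B : 'M[R]_(m, n)) (C : 'M[R]_(n, m)) (D D' : 'M[R]_n) : D *m D' = 1%:M ->
  \det (block_mx A B C D) = \det D * \det (A - B *m D' *m C).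
Proof.
(* Right multiplication by the unipotent [U] turns the lower left block into [C - D *m D' *m C],
   which is 0. *)
move=> DD'; pose U : 'M[R]_(m + n) := block_mx 1%:M 0 (- (D' *m C)) 1%:M.
have -> : \det (block_mx A B C D) = \det (block_mx A B C D *m U).
  by rewrite det_mulmx det_lblock !det1 !mulr1.
rewrite mulmx_block !mulmx1 !mulmx0 !mulmxN !add0r !mulmxA DD' mul1mx subrr.
by rewrite det_ublock mulrC.
Qed.

(** For nonzero [y], factoring out [y] leaves [y ^+ n] times the characteristic polynomial at
    [x / y]; the power is then shared among the [n] factors. *)
Lemma det_affine_eigenvalues (F : fieldType) (n : nat) (M : 'M[F]_n)
    (lam : 'I_n -> F) (x y : F) : eigenvalues_of M lam ->
  \det (x%:M - y *: M) = \prod_(j < n) (x - y * lam j).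
Proof.
move=> lamP; have [-> | y0] := eqVneq y 0.
  rewrite scale0r subr0 det_scalar -[in LHS](card_ord n) -prodr_const.
  by apply: eq_bigr => j _; rewrite mul0r subr0.
have -> : x%:M - y *: M = y *: ((x / y)%:M - M).
  by rewrite scalerBr scale_scalar_mx mulrC divfK.
rewrite detZ.
have -> : \det ((x / y)%:M - M) = (char_poly M).[x / y].
  rewrite -horner_evalE -det_map_mx; congr (\det _).
  by apply/matrixP=> i j; rewrite !mxE /= /horner_eval !(hornerE, hornerMn).
rewrite lamP horner_prod -[X in y ^+ X](card_ord n) -prodr_const -big_split.
by apply: eq_bigr => j _ /=; rewrite !hornerE mulrBr mulrCA divff ?mulr1.
Qed.

Lemma eigenvalues_of_map (F K : fieldType) (f : {rmorphism F -> K}) (n : nat)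
    (M : 'M[F]_n) (lam : 'I_n -> F) :
  eigenvalues_of M lam -> eigenvalues_of (map_mx f M) (f \o lam).
Proof.
rewrite /eigenvalues_of -map_char_poly => ->; rewrite rmorph_prod.
by apply: eq_bigr => j _; rewrite rmorphB /= map_polyX map_polyC.
Qed.

(** * Edges, incidence and the matrix P of a signed graph *)

Section Graph.
Variables (V : finType) (G : sigraph V).

Lemma edgeP (e : edge G) :
  exists u v, [/\ adj G u v, u != v & endpoints e = [set u; v]].
Proof.
case: e => e /= /[dup] /imsetP[[u v]]; rewrite inE /= => uv -> _.
by exists u, v; split=> //; apply/eqP=> E; rewrite E adj_irr in uv.
Qed.

Lemma card_endpoints (e : edge G) : #|endpoints e| = 2.
Proof. by have [u [v [_ uv ->]]] := edgeP e; rewrite cards2 uv. Qed.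

Lemma mem_edge_set u v : ([set u; v] \in edge_set G) = adj G u v.
Proof.
apply/idP/idP=> [euv | uv]; last by apply/imsetP; exists (u, v); rewrite ?inE.
(* Membership only yields some adjacent [a] and [b] spanning the same set, so [v] has to be matched
   with [b] or with [a]. *)
have [a [b [ab nab]]] := edgeP (exist (fun e => e \in edge_set G) _ euv).
rewrite /endpoints /= => E.
have /set2P[ua|ub] : u \in [set a; b] by rewrite -E set21.
- have : b \in [set u; v] by rewrite E set22.
  by rewrite !inE ua [b == a]eq_sym (negPf nab) => /eqP <-.
- have : a \in [set u; v] by rewrite E set21.
  by rewrite !inE ub (negPf nab) => /eqP <-; rewrite adj_sym.
Qed.

(** Sending a neighbour [w] to the pair of [u] and [w] is a bijection onto the edges at [u]; the
    absence of loops makes it injective. *)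
Lemma card_incident u : #|[set e : edge G | u \in endpoints e]| = degree G u.
Proof.
rewrite /degree -(card_imset _ val_inj).
have inj : {in [set w | adj G u w] &, injective (fun w => [set u; w])}.
  move=> v w; rewrite !inE => uv uw E.
  have : v \in [set u; w] by rewrite -E set22.
  by case/set2P=> [vu|//]; rewrite vu adj_irr in uv.
rewrite -(card_in_imset inj); apply: eq_card => A.
apply/imsetP/imsetP=> [[e] | [w]]; rewrite inE => ue ->; last first.
  rewrite -mem_edge_set in ue; exists (exist (fun e => e \in edge_set G) _ ue) => //.
  by rewrite inE /endpoints /= set21.
have [a [b [ab nab E]]] := edgeP e.
move: ue; rewrite -/(endpoints e) E => /set2P[->|->].
  by exists b; rewrite ?inE.
by exists a; rewrite ?inE 1?adj_sym // setUC.
Qed.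

(** This is R R^T = D + A entrywise. On the diagonal each incident edge gives a squared sign; for
    distinct [u] and [v] only the edge joining them can contribute, with the value given by
    [theta_sigma]. *)
Lemma sum_theta (th : r_orientation G) u v :
  \sum_e th u e * th v e =
  (degree G u)%:R *+ (u == v) + (if adj G u v then sigma G u v else 0).
Proof.
have [<- | nuv] := eqVneq u v.
  rewrite adj_irr addr0 -card_incident -sum1_card natr_sum.
  rewrite [RHS]big_mkcond; apply: eq_bigr => e _; rewrite inE.
  case: ifPn => [/(theta_end th) | /(theta_out th) ->]; last by rewrite mul0r.
  by case=> ->.
rewrite add0r; case: ifPn => uv.
  have euv := uv; rewrite -mem_edge_set in euv.
  rewrite (bigD1 (exist (fun e => e \in edge_set G) _ euv)) //= (@theta_sigma _ _ th u v) //.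
  rewrite big1 ?addr0 // => e ne; apply/eqP; rewrite mulf_eq0.
  apply: contraNT ne; rewrite negb_or => /andP[tu tv].
  rewrite -val_eqE /= eq_sym eqEcard cards2 nuv -/(endpoints e) card_endpoints andbT.
  by apply/subsetP=> w /set2P[]->; [apply: contraNT tu | apply: contraNT tv];
    move/(theta_out th) => ->.
rewrite big1 // => e _; apply/eqP; rewrite mulf_eq0.
apply: contraNT uv; rewrite negb_or -mem_edge_set => /andP[tu tv].
suff -> : [set u; v] = endpoints e by apply: valP.
apply/eqP; rewrite eqEcard cards2 nuv card_endpoints andbT.
by apply/subsetP=> w /set2P[]->; [apply: contraNT tu | apply: contraNT tv];
  move/(theta_out th) => ->.
Qed.

(** [invmx] leaves a singular matrix unchanged, so the formula rests on the nonzero degrees, which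
    make [D'] a true inverse of [deg_mx]. *)
Lemma P_mxE (F : fieldType) : (forall v, (degree G v)%:R != 0 :> F) ->
  P_mx G F = \matrix_(i, j) ((degree G (enum_val i))%:R^-1 *
    if adj G (enum_val i) (enum_val j)
    then (sigma G (enum_val i) (enum_val j))%:~R else 0).
Proof.
move=> deg0; pose D' : 'M[F]_#|V| :=
  diag_mx (\row_i (degree G (enum_val i))%:R^-1).
have DD' : deg_mx G F *m D' = 1%:M.
  by rewrite mulmx_diag; apply/matrixP=> k l; rewrite !mxE divff.
have -> : P_mx G F = D' *m adj_mx G F.
  congr (_ *m _).
  by rewrite -[RHS](mulKmx (proj1 (mulmx1_unit DD'))) DD' mulmx1.
by rewrite mul_diag_mx; apply/matrixP=> i j; rewrite !mxE.
Qed.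

End Graph.

(** * Degrees in the edge corona *)

Section Corona.
Variables (V1 V2 : finType) (G1 : signed_graph V1).
Variables (th : r_orientation G1) (G2 : signed_graph V2).

Lemma degree_corona_inl u :
  degree (edge_corona th G2) (inl u) = (degree G1 u * (#|V2| + 1))%N.
Proof.
rewrite /degree -!sum1dep_card big_sumType /= sum1dep_card mulnDr muln1 addnC.
congr (_ + _)%N.
(* The added [&& true] gives the predicate the product form that [pair_big] splits. *)
rewrite (eq_bigl (fun p : edge G1 * V2 => (u \in endpoints p.1) && true));
  last by case=> e w; rewrite andbT.
rewrite -(pair_big (fun e => u \in endpoints e) predT (fun _ _ => 1%N)) /=.
by rewrite !sum_nat_cond_const muln1 card_incident -[in RHS]cardsT.
Qed.

Lemma degree_corona_inr e w :
  degree (edge_corona th G2) (inr (e, w)) = (degree G2 w + 2)%N.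
Proof.
rewrite /degree -!sum1dep_card big_sumType /= addnC; congr (_ + _)%N; last first.
  by rewrite sum1dep_card cardsE card_endpoints.
rewrite (eq_bigl (fun p : edge G1 * V2 => (e == p.1) && adj G2 w p.2));
  last by case.
rewrite -(pair_big (fun f => e == f) (adj G2 w) (fun _ _ => 1%N)) /=.
by rewrite (eq_bigl (pred1 e)) ?big_pred1_eq // => f; rewrite eq_sym.
Qed.

End Corona.

(** * Constants and the indeterminate among rational functions *)

HB.instance Definition _ (F : fieldType) :=
  GRing.RMorphism.copy (@ratC F) (@FracField.tofrac {poly F} \o @polyC F).

Lemma tofrac_char_poly (F : fieldType) (n : nat) (M : 'M[F]_n) :
  FracField.tofrac (char_poly M) = \det ((ratX F)%:M - map_mx (@ratC F) M).
Proof.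
rewrite -det_map_mx; congr (\det _).
by apply/matrixP=> i j; rewrite !mxE rmorphB rmorphMn.
Qed.

Lemma ratX_sub_ratC_neq0 (F : fieldType) (a : F) : ratX F - ratC a != 0.
Proof. by rewrite -tofracB tofrac_eq0 polyXsubC_eq0. Qed.

(** * Ordering of the corona vertices *)

Section CoronaIndex.
Variables (V1 V2 : finType) (G1 : signed_graph V1).

(** The second summand is the index type of a [\mxdiag] with one block of size [#|V2|] per edge:
    [sig1] gives the block, [sig2] the position in it. *)
Definition corona_index
    (s : 'I_(#|V1| + \sum_(e < #|edge G1|) #|V2|)) : corona_vertex V2 G1 :=
  match split s with
  | inl i => inl (enum_val i)
  | inr k => inr (enum_val (tagnat.sig1 k), enum_val (tagnat.sig2 k))
  end.

Lemma corona_index_bij : bijective corona_index.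
Proof.
pose g (x : corona_vertex V2 G1) :
    'I_(#|V1| + \sum_(e < #|edge G1|) #|V2|) :=
  match x with
  | inl u => lshift _ (enum_rank u)
  | inr p => rshift _ (tagnat.Rank (enum_rank p.1) (enum_rank p.2))
  end.
exists g => [s | [u | [e w]]].
- rewrite -[s in RHS]splitK /corona_index; case: (split s) => [i | k] /=.
    by rewrite enum_valK.
  by rewrite !enum_valK tagnat.sig2K.
- by rewrite /corona_index (unsplitK (inl _)) enum_rankK.
- rewrite /corona_index (unsplitK (inr _)); congr (inr (_, _)).
    by rewrite tagnat.Rank1K enum_rankK.
  by rewrite tagnat.Rank2K -[RHS]enum_rankK; congr enum_val; apply/val_inj.
Qed.

End CoronaIndex.

(** * The determinant of the corona *)

(** Constants enter through a morphism [f], later [ratC]. The eigenvalues of b A2 lie in its image,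
    so [lambda_neq] makes lambda - b A2 invertible. *)
Lemma det_corona (F : numFieldType) (K : fieldType) (f : {rmorphism F -> K})
    (lambda : K) (V1 V2 : finType) (G1 : signed_graph V1)
    (th : r_orientation G1) (G2 : signed_graph V2) (gamma : nat)
    (G1_deg : forall v : V1, (0 < degree G1 v)%N)
    (G2_deg : forall w : V2, (0 < degree G2 w)%N)
    (G2_reg : regular G2 gamma)
    (lam1 : 'I_#|V1| -> F) (lam1P : eigenvalues_of (P_mx G1 F) lam1)
    (lam2 : 'I_#|V2| -> F) (lam2P : eigenvalues_of (P_mx G2 F) lam2)
    (lambda_neq : forall a, lambda != f a) :
  let mu2 := map_mx f (marking_vec F G2) in
  let S := (mu2^T *m invmx ((gamma%:R * lambda + 2%:R * lambda)%:M
                            - map_mx f (adj_mx G2 F)) *m mu2) 0 0 in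
  \det (lambda%:M - map_mx f (P_mx (edge_corona th G2) F)) =
    \prod_(j < #|V2|)
      (lambda - f (gamma%:R / (gamma%:R + 2%:R) * lam2 j)) ^+ #|edge_set G1|
    * \prod_(j < #|V1|)
        (lambda - f (lam1 j / (#|V2|%:R + 1))
         - f ((1 + lam1 j) / (#|V2|%:R + 1)) * S).
Proof.
move=> mu2 S; pose n2 := #|V2|.
have deg0 V (G : sigraph V) :
    (forall v, (0 < degree G v)%N) -> forall v, (degree G v)%:R != 0 :> F.
  by move=> Gdeg v; rewrite pnatr_eq0 -lt0n.
have deg1 := deg0 _ _ G1_deg; have deg2 := deg0 _ _ G2_deg.
have degc : forall x, (degree (edge_corona th G2) x)%:R != 0 :> F.
  apply: deg0 => -[u | [e w]]; last by rewrite degree_corona_inr addn2.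
  by rewrite degree_corona_inl muln_gt0 G1_deg addn1.
pose a : F := (n2%:R + 1)^-1; pose b : F := (gamma%:R + 2%:R)^-1.
have g2 : gamma%:R + 2%:R != 0 :> F by rewrite -natrD pnatr_eq0 addn2.
pose P1 := map_mx f (P_mx G1 F); pose A2 := map_mx f (adj_mx G2 F).
pose B := lambda%:M - f b *: A2.
(* [r e] and [rho e] are the columns at [e] of R and of D1^-1 R. *)
pose r (e : edge G1) : 'cV[K]_#|V1| := \col_i f (th (enum_val i) e)%:~R.
pose rho (e : edge G1) : 'cV[K]_#|V1| :=
  \col_i f ((th (enum_val i) e)%:~R / (degree G1 (enum_val i))%:R).
have detB : \det B = \prod_j (lambda - f (gamma%:R / (gamma%:R + 2%:R) * lam2 j)).
  have -> : B = lambda%:M - f (gamma%:R * b) *: map_mx f (P_mx G2 F).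
    congr (_ - _); apply/matrixP=> i j; rewrite P_mxE // !mxE -!rmorphM /=.
    rewrite G2_reg; congr (f _); rewrite mulrA; congr (_ * _).
    (* [gamma] is nonzero here because it is the degree of an actual vertex; if [V2] is empty there
       are no entries to compare. *)
    by rewrite mulrAC divff ?mul1r // -(G2_reg (enum_val i)).
  rewrite (det_affine_eigenvalues _ _ _ _ _ _ (eigenvalues_of_map _ _ f _ _ _ lam2P)).
  by apply: eq_bigr => j _; rewrite /= -rmorphM.
have Bunit : B \in unitmx.
  rewrite unitmxE unitfE detB; apply/prodf_neq0 => j _.
  by rewrite subr_eq0.
have coronalE : S = f b * (mu2^T *m invmx B *m mu2) 0 0.
  have b0 : f b != 0 by rewrite fmorph_eq0 invr_eq0.
  rewrite /S -/A2.
  have -> : (gamma%:R * lambda + 2%:R * lambda)%:M - A2 = (f b)^-1 *: B.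
    rewrite scalerBr scale_scalar_mx scalerA mulVf // scale1r -mulrDl.
    by rewrite -fmorphV invrK rmorphD !rmorph_nat.
  rewrite invmxZ ?unitmxZ ?unitfE ?invr_eq0 // invrK.
  by rewrite -scalemxAr -scalemxAl mxE.
(* From here on [S] is just a scalar of [K], known through [coronalE]. *)
clearbody S.
(* The sum of these outer products is D1^-1 R R^T, evaluated by [sum_theta]. *)
have rhor : \sum_(e < #|edge G1|) rho (enum_val e) *m (r (enum_val e))^T = 1%:M + P1.
  apply/matrixP=> i j; rewrite /P1 P_mxE // summxE !mxE.
  pose g (e : edge G1) : K := f ((degree G1 (enum_val i))%:R^-1 *
    (th (enum_val i) e * th (enum_val j) e)%:~R).
  transitivity (\sum_e g e).
    rewrite (reindex (@enum_val (edge G1) (edge G1))) /=; last first.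
      exact/onW_bij/enum_val_bij.
    apply: eq_bigr => e _; rewrite mxE big_ord1 !mxE -rmorphM /g intrM; congr (f _).
    by rewrite mulrAC mulrC.
  rewrite -rmorph_sum -mulr_sumr -rmorph_sum sum_theta rmorphD mulrDr rmorphD /=.
  congr (_ + _); last by case: ifP => _; rewrite ?mul0r ?mulr0.
  rewrite rmorphMn /= rmorph_nat mulrnAr mulVf ?rmorphMn ?rmorph1 //.
  by rewrite (inj_eq enum_val_inj).
pose q (x y : corona_vertex V2 G1) : K := lambda *+ (x == y) -
  f ((degree (edge_corona th G2) x)%:R^-1 *
      (if corona_adj G2 x y then (corona_sigma th G2 x y)%:~R else 0)).
have -> : lambda%:M - map_mx f (P_mx (edge_corona th G2) F) =
    \matrix_(i, j) q (enum_val i) (enum_val j).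
  apply/matrixP=> i j; rewrite P_mxE // !mxE /q.
  by rewrite (inj_eq enum_val_inj).
rewrite (det_reindex _ _ _ _ _ (corona_index_bij V1 V2 G1)).
set M := \matrix_(i, j) _.
(* The Kronecker products are cut edge by edge, so each off-diagonal piece is an outer product of
   two vectors. *)
have -> : M = block_mx (lambda%:M - f a *: P1)
    (\mxrow_(e < #|edge G1|) (- f a *: (rho (enum_val e) *m mu2^T)))
    (\mxcol_(e < #|edge G1|) (- f b *: (mu2 *m (r (enum_val e))^T)))
    (\mxdiag_(e < #|edge G1|) B).
  have na : ((n2 + 1)%:R)^-1 = a by rewrite natrD.
  have ng : ((gamma + 2)%:R)^-1 = b by rewrite natrD.
  have thetaE u e z :
      (if u \in endpoints e then (th u e * z)%:~R else 0) =
      (th u e)%:~R * z%:~R :> F.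
    by case: ifPn => [_ | /(theta_out th) ->]; rewrite ?mul0r // intrM.
  apply/matrixP=> i j; rewrite mxE -[i]splitK -[j]splitK.
  case: (split i) => {}i; case: (split j) => {}j.
  - rewrite block_mxEul /corona_index !(unsplitK (inl _)) /q /= degree_corona_inl.
    rewrite /P1 P_mxE // !mxE (inj_eq inl_inj) (inj_eq enum_val_inj).
    by rewrite -rmorphM natrM invfM na mulrCA mulrA.
  - rewrite block_mxEur /corona_index (unsplitK (inl _)) (unsplitK (inr _)) /q /=.
    rewrite degree_corona_inl thetaE !mxE big_ord1 !mxE sub0r mulNr; congr (- _).
    rewrite -!rmorphM; congr (f _); rewrite natrM invfM na; ring.
  - rewrite block_mxEdl /corona_index (unsplitK (inl _)) (unsplitK (inr _)) /q /=.
    rewrite degree_corona_inr G2_reg thetaE !mxE big_ord1 !mxE sub0r mulNr ng.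
    congr (- _); rewrite -!rmorphM; congr (f _); ring.
  - rewrite block_mxEdr /corona_index !(unsplitK (inr _)) /q /=.
    rewrite degree_corona_inr G2_reg ng mxE (inj_eq inr_inj) xpair_eqE.
    rewrite !(inj_eq enum_val_inj); case: eqP => _ /=; last first.
      by rewrite mxE mulr0 rmorph0 subr0.
    by rewrite conform_mx_id !mxE -rmorphM.
rewrite (@det_schur _ _ _ _ _ _ _ (\mxdiag_(e < #|edge G1|) invmx B)); last first.
  have -> : \mxdiag_(e < #|edge G1|) B *m \mxdiag_(e < #|edge G1|) invmx B =
      \mxdiag_(e < #|edge G1|) (B *m invmx B).
    rewrite {2}/mxdiag mul_mxdiag_mxblock; apply: eq_mxblock => i j.
    by case: eqP => _; rewrite ?mulmx0 // !conform_mx_id.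
  by rewrite mulmxV // mxdiagZ.
rewrite det_mxdiag detB prodr_const card_ord -prodrXl.
congr (_ * _); first by rewrite card_sig.
rewrite mul_mxrow_mxdiag mul_mxrow_mxcol.
transitivity (\det ((lambda - f a * S)%:M - (f a * (1 + S)) *: P1)).
  congr (\det _).
  (* In each summand the middle factor mu^T B^-1 mu is a 1 x 1 matrix; pulled out as a scalar, it
     absorbs [f b] to give [S], and the two minus signs cancel. *)
  have -> : \sum_(i < #|edge G1|) (- f a *: (rho (enum_val i) *m mu2^T)) *m invmx B *m
      (- f b *: (mu2 *m (r (enum_val i))^T)) = f a * S *: (1%:M + P1).
    rewrite -rhor scaler_sumr; apply: eq_bigr => e _.
    rewrite -!scalemxAl -scalemxAr scalerA mulrNN !mulmxA.
    rewrite -2!(mulmxA (rho _)) [mu2^T *m _ *m _]mx11_scalar.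
    by rewrite mul_mx_scalar -scalemxAl scalerA coronalE mulrA.
  rewrite scalerDr scalemx1 raddfB /= mulrDr mulr1 scalerDl !opprD.
  by rewrite addrACA.
rewrite (det_affine_eigenvalues _ _ _ _ _ _ (eigenvalues_of_map _ _ f _ _ _ lam1P)).
apply: eq_bigr => j _; rewrite /= !rmorphM rmorphD rmorph1 -/a; ring.
Qed.

Theorem theorem6p4 (C : numClosedFieldType) (V1 V2 : finType)
    (G1 : signed_graph V1) (th : r_orientation G1)
    (G2 : signed_graph V2) (gamma : nat)
    (G1_deg : forall v : V1, (0 < degree G1 v)%N)
    (G2_deg : forall w : V2, (0 < degree G2 w)%N)
    (G2_reg : regular G2 gamma)
    (lam1 : 'I_#|V1| -> C) (lam1P : eigenvalues_of (P_mx G1 C) lam1)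
    (lam2 : 'I_#|V2| -> C) (lam2P : eigenvalues_of (P_mx G2 C) lam2) :
  let n2 := #|V2| in
  let m1 := #|edge_set G1| in
  let lambda := ratX C in
  FracField.tofrac (char_poly (P_mx (edge_corona th G2) C)) =
    \prod_(j < #|V2|)
      (lambda - ratC (gamma%:R / (gamma%:R + 2%:R) * lam2 j)) ^+ m1
    * \prod_(j < #|V1|)
        (lambda - ratC (lam1 j / (n2%:R + 1))
         - ratC ((1 + lam1 j) / (n2%:R + 1))
           * coronal G2 (adj_mx G2 C) (gamma%:R * lambda + 2%:R * lambda)).
Proof.
move=> n2 m1 lambda; rewrite tofrac_char_poly.
apply: (det_corona _ _ (@ratC C)) => // a.
by rewrite -subr_eq0 ratX_sub_ratC_neq0.
Qed.
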